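(* Let $G=(V,E)$ be a finite simple directed graph with transitive closure $G^*$. If $O$ is a transitive orientation of the undirected complement $\overline{\mathcal{U}(G)}$, then the restriction of $O$ to the edges of $\overline{\mathcal{U}(G^* )}$ is a transitive orientation of $\overline{\mathcal{U}(G^* )}$.
   Context: Graphs are simple and directed; an undirected graph has $E=E^{-1}$ where $E^{-1}=\{(b,a)\mid(a,b)\in E\}$. $\mathcal{U}(G)=(V,E\cup E^{-1})$; the complement of $(V,F)$ is $(V,\{(a,b):a\neq b\}\setminus F)$; $\overline{\mathcal{U}(G)}$ is the complement of $\mathcal{U}(G)$. $G^*=(V,E^* )$ with $E^*$ the minimal transitive superset of $E$, where a graph is transitive iff $(a,b),(b,c)\in E$, $a\neq c$ imply $(a,c)\in E$. Note $\overline{\mathcal{U}(G^* )}$ is a subgraph of $\overline{\mathcal{U}(G)}$. A graph is oriented if $E\cap E^{-1}=\emptyset$; an orientation of $(V,E)$ is $(V,E')$ with $E'$ a maximal oriented subset of $E$; a transitive orientation is an orientation that is transitive. *)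

(* Defs.v *)
From mathcomp Require Import all_boot.

Set Implicit Arguments.
Unset Strict Implicit.
Unset Printing Implicit Defensive.

(* A graph (V, E) on the finite vertex type V is represented by its edge set
   E : {set V * V}; it is a simple directed graph when [simple E] holds. *)

Definition simple (V : finType) (E : {set V * V}) : bool :=
  [forall a : V, (a, a) \notin E].

Definition converse (V : finType) (E : {set V * V}) : {set V * V} :=
  [set p | (p.2, p.1) \in E].

Definition underlying (V : finType) (E : {set V * V}) : {set V * V} :=
  E :|: converse E.

(* Complement among the non-loops, so it differs from the set complement ~: E. *)
Definition gcompl (V : finType) (E : {set V * V}) : {set V * V} :=
  [set p | p.1 != p.2] :\: E.

(* The side condition a != c keeps loops out, unlike ssrbool's [transitive]. *)
Definition gtransitive (V : finType) (E : {set V * V}) : bool :=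
  [forall a : V, forall b : V, forall c : V,
     [&& (a, b) \in E, (b, c) \in E & a != c] ==> ((a, c) \in E)].

Definition transitive_closure (V : finType) (E Estar : {set V * V}) : bool :=
  minset (fun F : {set V * V} => [&& simple F, gtransitive F & E \subset F])
         Estar.

Definition oriented (V : finType) (E : {set V * V}) : bool :=
  E :&: converse E == set0.

Definition orientation (V : finType) (E O : {set V * V}) : bool :=
  maxset (fun F : {set V * V} => oriented F && (F \subset E)) O.

Definition transitive_orientation (V : finType) (E O : {set V * V}) : bool :=
  orientation E O && gtransitive O.

(* The transitive closure relation is functional on simple graphs. *)
Lemma transitive_closure_exists (V : finType) (E : {set V * V}) :
  simple E -> exists Estar : {set V * V}, transitive_closure E Estar.
Proof.
move=> /forallP sE.
pose P (F : {set V * V}) := [&& simple F, gtransitive F & E \subset F].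
have PT : P [set p | p.1 != p.2].
  apply/and3P; split.
  - by apply/forallP=> a; rewrite inE /= eqxx.
  - apply/forallP=> a; apply/forallP=> b; apply/forallP=> c.
    by apply/implyP=> /and3P[_ _ ac]; rewrite inE.
  - apply/subsetP=> -[a b] abE; rewrite inE /=.
    by apply/eqP=> ab; move: (sE a); rewrite {2}ab abE.
by have [A minA _] := minset_exists (C := [set p | p.1 != p.2]) PT; exists A.
Qed.

Lemma transitive_closure_unique (V : finType) (E F1 F2 : {set V * V}) :
  transitive_closure E F1 -> transitive_closure E F2 -> F1 = F2.
Proof.
move=> /minsetP[/and3P[s1 t1 E1] m1] /minsetP[/and3P[_ t2 E2] m2].
have PI : [&& simple (F1 :&: F2), gtransitive (F1 :&: F2) & E \subset F1 :&: F2].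
  apply/and3P; split.
  - by apply/forallP=> a; rewrite inE negb_and (forallP s1 a).
  - apply/forallP=> a; apply/forallP=> b; apply/forallP=> c.
    apply/implyP=> /and3P[/setIP[ab1 ab2] /setIP[bc1 bc2] ac].
    rewrite inE; apply/andP; split.
      by apply: (implyP (forallP (forallP (forallP t1 a) b) c)); apply/and3P.
    by apply: (implyP (forallP (forallP (forallP t2 a) b) c)); apply/and3P.
  - by rewrite subsetI E1.
by rewrite -(m1 _ PI (subsetIl _ _)) [RHS](esym (m2 _ PI (subsetIr _ _))).
Qed.

(* Main.v *)
Require Import Defs.
From mathcomp Require Import all_boot.

(** Suppose a -> b -> c in O, with b incomparable to a and to c in G^*.
    Every vertex on a path of G between a and c is then incomparable to b, so O
    orients its pair with b. Along a single edge (x, y) of G that orientation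
    cannot change: x -> b -> y in O would force (x, y) in O, outside U(G).
    As a and c lie on different sides of b, no such path exists. *)

Lemma gtransitiveP (V : finType) (E : {set V * V}) :
  reflect (forall a b c, (a, b) \in E -> (b, c) \in E -> a != c ->
             (a, c) \in E)
          (gtransitive E).
Proof.
apply: (iffP forallP) => [tE a b c ab bc ac | tE a].
  by have /forallP/(_ b)/forallP/(_ c)/implyP := tE a; apply; apply/and3P.
apply/forallP=> b; apply/forallP=> c.
by apply/implyP=> /and3P[]; apply: tE.
Qed.

Lemma orientedP (V : finType) (O : {set V * V}) :
  reflect (forall a b, (a, b) \in O -> (b, a) \notin O) (oriented O).
Proof.
apply: (iffP eqP) => [O0 a b ab | oO].
  by move/setP/(_ (a, b)): O0; rewrite !inE ab /= => ->.
apply/setP=> -[a b]; rewrite !inE /=.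
by apply/negP=> /andP[/oO/negP].
Qed.

Lemma in_gcompl_underlying (V : finType) (E : {set V * V}) (a b : V) :
  ((a, b) \in gcompl (underlying E)) =
    [&& a != b, (a, b) \notin E & (b, a) \notin E].
Proof. by rewrite !inE /= negb_or andbC. Qed.

Lemma gcompl_underlying_sym (V : finType) (E : {set V * V}) (a b : V) :
  ((a, b) \in gcompl (underlying E)) = ((b, a) \in gcompl (underlying E)).
Proof. by rewrite !in_gcompl_underlying eq_sym [X in _ && X]andbC. Qed.

(** An edge of [H] missing from [O] in both directions could be added, contradicting maximality;
    irreflexivity ensures that the added pair is not its own reverse. Conversely, a pair of an
    oriented set between [O] and [H] cannot have its reverse in [O], so totality puts the pair
    itself in [O]. *)
Lemma orientationP (V : finType) (H O : {set V * V})
    (irrH : forall a, (a, a) \notin H)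
    (symH : forall a b, ((a, b) \in H) = ((b, a) \in H)) :
  reflect [/\ oriented O, O \subset H &
              forall a b, (a, b) \in H -> ((a, b) \in O) || ((b, a) \in O)]
          (orientation H O).
Proof.
apply: (iffP maxsetP) => [[/andP[oO sOH] maxO] | [oO sOH totO]]; split=> //.
- move=> a b abH; apply: contraT; rewrite negb_or => /andP[abO baO].
  have ab : a != b by apply: contraNneq (irrH a) => {2}->.
  suff /maxO OE : oriented ((a, b) |: O) && ((a, b) |: O \subset H).
    by rewrite -OE ?subsetUr // setU11 in abO.
  rewrite subUset sub1set abH sOH !andbT.
  apply/orientedP=> x y; rewrite !inE !xpair_eqE.
  case/orP=> [/andP[/eqP-> /eqP->] | xyO].
    by rewrite negb_or baO negb_and eq_sym ab.
  rewrite negb_or (orientedP _ _ oO _ _ xyO) andbT.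
  by apply: contraNN baO => /andP[/eqP<- /eqP<-].
- by rewrite oO.
- move=> F /andP[/orientedP oF /subsetP sFH] sOF.
  apply/eqP; rewrite eqEsubset sOF andbT; apply/subsetP=> -[a b] abF.
  case/orP: (totO _ _ (sFH _ abF)) => // /(subsetP sOF).
  by rewrite (negPf (oF _ _ abF)).
Qed.

Lemma orientation_gcomplP (V : finType) (E O : {set V * V}) :
  reflect [/\ oriented O, O \subset gcompl (underlying E) &
              forall a b, (a, b) \in gcompl (underlying E) ->
                ((a, b) \in O) || ((b, a) \in O)]
          (orientation (gcompl (underlying E)) O).
Proof.
apply: orientationP => [a | a b]; last exact: gcompl_underlying_sym.
by rewrite in_gcompl_underlying eqxx.
Qed.

(* Minimality of the closure is used as an induction principle: the pairs of
   Estar satisfying the conclusion form a transitive graph containing E. *)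
Lemma closure_same_side (V : finType) (E Estar O : {set V * V}) (b : V)
    (hEstar : transitive_closure E Estar)
    (hO : transitive_orientation (gcompl (underlying E)) O) (x y : V) :
  (x, y) \in Estar ->
  (x, b) \in gcompl (underlying Estar) ->
  (y, b) \in gcompl (underlying Estar) ->
  ((x, b) \in O) = ((y, b) \in O).
Proof.
have /minsetP[/and3P[sS /gtransitiveP tS sES] minS] := hEstar.
have /andP[/orientation_gcomplP[/orientedP oO sOH totO] /gtransitiveP tO] := hO.
set H := gcompl (underlying Estar).
(* Closing [E] only removes pairs from the complement, so [O] still orients every pair of [H]. *)
have HG u v : (u, v) \in H -> (u, v) \in gcompl (underlying E).
  rewrite !in_gcompl_underlying => /and3P[-> uv vu] /=.
  by rewrite (contraNN (subsetP sES _) uv) (contraNN (subsetP sES _) vu).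
(* With implications, a pair of [Estar] having an end equal or comparable to [b] belongs to [F]
   vacuously; this lets [F] contain all of [E]. *)
pose F := [set p in Estar | ((p.1, b) \in H) ==> (((p.2, b) \in H) ==>
             (((p.1, b) \in O) == ((p.2, b) \in O)))].
have inF u v : ((u, v) \in F) = ((u, v) \in Estar) &&
    (((u, b) \in H) ==> (((v, b) \in H) ==>
      (((u, b) \in O) == ((v, b) \in O)))) by rewrite inE.
suff FS : F = Estar.
  by rewrite -FS inF => /andP[_ /implyP xyF] /xyF/implyP yF /yF/eqP.
have sFS : F \subset Estar by apply/subsetP=> p; rewrite inE => /andP[].
apply: minS => //; apply/and3P; split.
- apply/forallP=> a; apply: contraNN (forallP sS a); exact: (subsetP sFS).
- apply/gtransitiveP=> u v w; rewrite !inF.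
  move=> /andP[uv uvF] /andP[vw vwF] uw.
  rewrite (tS u v w) //=; apply/implyP=> uH; apply/implyP=> wH.
  (* The middle vertex must not fall under the vacuous case: [v = b] or [v] below [b] would put
     [(u, b)] in [Estar], and [b] below [v] would put [(b, w)] there. *)
  suff vH : (v, b) \in H.
    by move: uvF vwF; rewrite uH vH wH /= => /eqP-> /eqP->.
  move: uH wH; rewrite !in_gcompl_underlying.
  move=> /and3P[ub ubS buS] /and3P[wb wbS bwS]; apply/and3P; split.
  + by apply: contraNneq ubS => <-.
  + by apply: contraNN ubS => vb; apply: tS uv vb ub.
  + by apply: contraNN bwS => bv; apply: tS bv vw _; rewrite eq_sym.
- have edgeNO u v : (u, v) \in E -> ((u, v) \notin O) /\ ((v, u) \notin O).
    move=> uvE; split; apply: contraTN uvE => /(subsetP sOH);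
      by rewrite in_gcompl_underlying => /and3P[].
  apply/subsetP=> -[u v] uvE; rewrite inF (subsetP sES) //=.
  apply/implyP=> uH; apply/implyP=> vH.
  have [uvO vuO] := edgeNO _ _ uvE.
  have uv : u != v.
    apply: contraTneq (subsetP sES _ uvE) => ->; exact: (forallP sS).
  (* In the two mixed cases [b] is the middle of a path of [O] joining [u] and [v], which
     contradicts [edgeNO]. When both pairs point away from [b], both memberships are false. *)
  case/orP: (totO _ _ (HG _ _ uH)) => ubO;
    case/orP: (totO _ _ (HG _ _ vH)) => vbO.
  + by rewrite ubO vbO.
  + by rewrite (tO _ _ _ ubO vbO uv) in uvO.
  + by rewrite (tO _ _ _ vbO ubO) 1?eq_sym in vuO.
  + by rewrite (negPf (oO _ _ ubO)) (negPf (oO _ _ vbO)).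
Qed.

Theorem theorem4 (V : finType) (E Estar O : {set V * V})
    (hE : simple E) (hEstar : transitive_closure E Estar)
    (hO : transitive_orientation (gcompl (underlying E)) O) :
  transitive_orientation (gcompl (underlying Estar))
    (O :&: gcompl (underlying Estar)).
Proof.
have /minsetP[/and3P[_ _ sES] _] := hEstar.
have /andP[/orientation_gcomplP[/orientedP oO _ totO] /gtransitiveP tO] := hO.
have side := closure_same_side _ _ _ _ _ hEstar hO.
apply/andP; split.
  apply/orientation_gcomplP; split; last 1 first.
  (* The complement is symmetric, so the restriction keeps whichever direction [O] chose. *)
  - move=> a b abH; rewrite !in_setI -(gcompl_underlying_sym _ _ a) abH !andbT.
    apply: totO; move: abH; rewrite !in_gcompl_underlying => /and3P[-> ab ba].
    by rewrite (contraNN (subsetP sES _) ab) (contraNN (subsetP sES _) ba).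
  - apply/orientedP=> a b /setIP[abO _].
    by rewrite in_setI (negPf (oO _ _ abO)).
  - exact: subsetIr.
apply/gtransitiveP=> a b c /setIP[abO abH] /setIP[bcO bcH] ac.
rewrite in_setI (tO _ _ _ abO bcO ac) in_gcompl_underlying ac /=.
(* Written with [b] second, as [side] requires, [(a, b)] is in [O] and [(c, b)] is not; a pair of
   [Estar] joining [a] and [c] in either direction would make these agree. *)
rewrite gcompl_underlying_sym in bcH; have cbO := oO _ _ bcO.
apply/andP; split; apply: contraNN cbO => acS.
  by rewrite -(side b _ _ acS).
by rewrite (side b _ _ acS).
Qed.
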